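(* For all real numbers $a,b>0$, the six means $A,G,H,N,C,R$ evaluated at $(a,b)$ satisfy the following proportionality relations: (1) $4A=2(C+H)=3R+H$; (2) $3R=C+2A=2C+H$; (3) $3N=2A+G$; (4) $3C+2H=3R+2A$; (5) $C+6A=H+6R$; (6) $C+3N=G+3R$; (7) $3N+2A=2C+2H+G$; (8) $27R+2G=14A+9C+6N$; (9) $3(N+3R)=8A+3C+G$; (10) $3G+8H+9C=3R+8A+9N$; (11) $4G+14H+17C=9R+14A+12N$; (12) $5G+24H+31C=21R+24A+15N$.
   Context: For real numbers $a,b>0$ the means are: arithmetic $A=A(a,b)=\frac{a+b}{2}$; geometric $G=G(a,b)=\sqrt{ab}$; harmonic $H=H(a,b)=\frac{2ab}{a+b}$; Heronian $N=N(a,b)=\frac{a+\sqrt{ab}+b}{3}$; contra-harmonic $C=C(a,b)=\frac{a^2+b^2}{a+b}$; centroidal $R=R(a,b)=\frac{2(a^2+ab+b^2)}{3(a+b)}$. *)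

(* Defs.v *)
From Stdlib Require Import Reals.
Open Scope R_scope.

Definition arithmetic_mean (a b : R) : R := (a + b) / 2.

Definition geometric_mean (a b : R) : R := sqrt (a * b).

Definition harmonic_mean (a b : R) : R := 2 * a * b / (a + b).

Definition heronian_mean (a b : R) : R := (a + sqrt (a * b) + b) / 3.

Definition contraharmonic_mean (a b : R) : R := (a ^ 2 + b ^ 2) / (a + b).

Definition centroidal_mean (a b : R) : R :=
  2 * (a ^ 2 + a * b + b ^ 2) / (3 * (a + b)).

(* Main.v *)
Require Import Defs.
From Stdlib Require Import Reals Lra.
Open Scope R_scope.

(* C, R and N are linear combinations of A, G and H; after substituting these,
   every relation is a linear identity in A, G and H. *)

(** Everything comes from the square (a + b)^2. Over the denominator a + b, the sum C + H has
    numerator a^2 + b^2 + 2ab = (a + b)^2, so it equals 2A; likewise 3R + H has numerator 2(a +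
    b)^2, so it equals 4A. With 3N = 2A + G, both sides of each relation have the same coefficients
    in A, G and H. *)

Lemma contraharmonic_mean_AH (a b : R) : a + b <> 0 ->
  contraharmonic_mean a b = 2 * arithmetic_mean a b - harmonic_mean a b.
Proof.
  intro hab; unfold contraharmonic_mean, arithmetic_mean, harmonic_mean.
  now field.
Qed.

Lemma centroidal_mean_AH (a b : R) : a + b <> 0 ->
  centroidal_mean a b = (4 * arithmetic_mean a b - harmonic_mean a b) / 3.
Proof.
  intro hab; unfold centroidal_mean, arithmetic_mean, harmonic_mean.
  now field.
Qed.

Lemma heronian_mean_AG (a b : R) :
  heronian_mean a b = (2 * arithmetic_mean a b + geometric_mean a b) / 3.
Proof.
  unfold heronian_mean, arithmetic_mean, geometric_mean; field.
Qed.

Theorem mainTheorem2 (a b : R) (ha : 0 < a) (hb : 0 < b) :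
  let AM := arithmetic_mean a b in
  let GM := geometric_mean a b in
  let HM := harmonic_mean a b in
  let NM := heronian_mean a b in
  let CM := contraharmonic_mean a b in
  let RM := centroidal_mean a b in
  (4 * AM = 2 * (CM + HM) /\ 2 * (CM + HM) = 3 * RM + HM) /\
  (3 * RM = CM + 2 * AM /\ CM + 2 * AM = 2 * CM + HM) /\
  3 * NM = 2 * AM + GM /\
  3 * CM + 2 * HM = 3 * RM + 2 * AM /\
  CM + 6 * AM = HM + 6 * RM /\
  CM + 3 * NM = GM + 3 * RM /\
  3 * NM + 2 * AM = 2 * CM + 2 * HM + GM /\
  27 * RM + 2 * GM = 14 * AM + 9 * CM + 6 * NM /\
  3 * (NM + 3 * RM) = 8 * AM + 3 * CM + GM /\
  3 * GM + 8 * HM + 9 * CM = 3 * RM + 8 * AM + 9 * NM /\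
  4 * GM + 14 * HM + 17 * CM = 9 * RM + 14 * AM + 12 * NM /\
  5 * GM + 24 * HM + 31 * CM = 21 * RM + 24 * AM + 15 * NM.
Proof.
  intros AM GM HM NM CM RM.
  assert (hab : a + b <> 0) by lra.
  assert (hC : CM = 2 * AM - HM) by now apply contraharmonic_mean_AH.
  assert (hR : RM = (4 * AM - HM) / 3) by now apply centroidal_mean_AH.
  assert (hN : NM = (2 * AM + GM) / 3) by apply heronian_mean_AG.
  (* From here [AM], [GM] and [HM] can be arbitrary reals: the relations follow from [hC], [hR] and
     [hN] alone, so forgetting the formulas leaves purely linear goals. *)
  clearbody AM GM HM NM CM RM.
  repeat split; lra.
Qed.
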